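(* Let $b<c$ be integers of the same parity. Then \[\sum_{c<n\leq N}\tau\big((n-b)(n-c)\big)\sim \frac{6}{\pi^2}\,N\log^2 N \qquad (N\to\infty).\]
   Context: $\tau(m)$ denotes the number of positive divisors of the positive integer $m$; the sum runs over integers $n$ with $c<n\le N$. *)

(* Defs.v *)
From Stdlib Require Import Reals ZArith Arith List.
Import ListNotations.

Definition tau (m : nat) : nat :=
  length (filter (fun d => Nat.eqb (m mod d) 0) (seq 1 m)).

Definition Zinterval_oc (c N : Z) : list Z :=
  map (fun k => (c + Z.of_nat k)%Z) (seq 1 (Z.to_nat (N - c))).

(* S(N) = sum_{c < n <= N} tau((n-b)(n-c)). For b < c < n the product is
   a positive integer, so Z.to_nat is harmless. *)
Definition S_tau (b c N : Z) : nat :=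
  fold_right Nat.add 0%nat
    (map (fun n => tau (Z.to_nat ((n - b) * (n - c)))) (Zinterval_oc c N)).

(* Main.v *)
Require Import Defs.
From Stdlib Require Import Reals ZArith Arith List Lra Lia.
From Coquelicot Require Import Coquelicot.
From mathcomp Require Import all_boot zify_ssreflect.
Set Implicit Arguments.
Unset Strict Implicit.
Open Scope R_scope.

(* With [h = c - b] and [m = n - c], the involution [d -> P / d] on the
   divisors of [P = m (m + h)] reduces the sum, up to [O(h)] per term, to twice
   the number [G_h(M)] of pairs [d <= m <= M] with [d | m (m + h)].  The triples
   [(m, g, e)] with [g | m], [e | m + h] and [g e <= m <= M] number
   [F_h(M) = sum_(f | h) G_(h / f)(M / f)]: divide out [f = gcd (m / g, e)].
   Counting [m = g y] in residue classes modulo [e] gives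
   [F_h(M) ~ M sum_(d | h) W(M / d^2) / d], where [W(X)] sums [1 / (g e)] over
   coprime [g, e] with [g e <= X].  The same sum without coprimality is
   [V(X) = sum_d W(X / d^2) / d^2 ~ (log X)^2 / 2]; as [V] varies slowly,
   [W ~ V / zeta(2)].  Hence [F_h ~ (3 / pi^2) (sum_(d | h) 1 / d) M (log M)^2],
   and strong induction on [h] in the formula for [F_h] gives
   [G_h ~ (3 / pi^2) M (log M)^2]. *)

(** * Finite sums *)

(* Sums start at 1: [rsum n F] is [F 1 + ... + F n]. *)
Fixpoint rsum (n : nat) (F : nat -> R) : R :=
  if n is k.+1 then rsum k F + F n else 0.

Notation "\rsum_ ( i <= n ) F" := (rsum n (fun i => F))
  (at level 41, F at level 41, i at level 0, n at level 50,
   format "\rsum_ ( i  <=  n )  F") : R_scope.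

Definition ind (b : bool) : R := if b then 1 else 0.

Lemma ind_and b1 b2 : ind (b1 && b2) = ind b1 * ind b2.
Proof. by case: b1; case: b2; rewrite /ind /=; lra. Qed.

Lemma ind_ge0 b : 0 <= ind b.
Proof. by case: b; rewrite /ind; lra. Qed.

Lemma ind_le1 b : ind b <= 1.
Proof. by case: b; rewrite /ind; lra. Qed.

Lemma ler_INR m n : (m <= n)%N -> INR m <= INR n.
Proof. by move=> /leP /le_INR. Qed.

Lemma INR_gt0 n : (0 < n)%N -> 0 < INR n.
Proof. by move=> /ltP /lt_0_INR. Qed.

Lemma eq_rsum n F G :
  (forall i, (0 < i <= n)%N -> F i = G i) -> rsum n F = rsum n G.
Proof.
elim: n => //= n IHn eqFG; rewrite IHn ?eqFG ?leqnn //.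
by move=> i /andP[i0 le_in]; apply: eqFG; rewrite i0 leqW.
Qed.

Lemma rsum_le n F G :
  (forall i, (0 < i <= n)%N -> F i <= G i) -> rsum n F <= rsum n G.
Proof.
elim: n => /= [|n IHn] leFG; first lra.
apply: Rplus_le_compat; last by apply: leFG; rewrite /= leqnn.
by apply: IHn => i /andP[i0 le_in]; apply: leFG; rewrite i0 leqW.
Qed.

Lemma rsum_const n c : \rsum_(i <= n) c = INR n * c.
Proof. by elim: n => [|n IHn]; rewrite ?S_INR /= ?IHn /=; lra. Qed.

Lemma rsum_ge0 n F :
  (forall i, (0 < i <= n)%N -> 0 <= F i) -> 0 <= rsum n F.
Proof. by move=> F0; have := rsum_le F0; rewrite rsum_const; lra. Qed.

Lemma rsumD n F G :
  \rsum_(i <= n) (F i + G i) = \rsum_(i <= n) F i + \rsum_(i <= n) G i.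
Proof. by elim: n => /= [|n ->]; lra. Qed.

Lemma rsumB n F G :
  \rsum_(i <= n) (F i - G i) = \rsum_(i <= n) F i - \rsum_(i <= n) G i.
Proof. by elim: n => /= [|n ->]; lra. Qed.

Lemma rsumZ n c F : \rsum_(i <= n) (c * F i) = c * \rsum_(i <= n) F i.
Proof. by elim: n => /= [|n ->]; lra. Qed.

Lemma rsum_dist_le n F G E :
  (forall i, (0 < i <= n)%N -> Rabs (F i - G i) <= E i) ->
  Rabs (rsum n F - rsum n G) <= rsum n E.
Proof.
elim: n => /= [|n IHn] H; first by rewrite Rminus_diag Rabs_R0; lra.
have {}IHn : Rabs (rsum n F - rsum n G) <= rsum n E.
  by apply: IHn => i /andP[i0 le_in]; apply: H; rewrite i0 leqW.
have := H n.+1; rewrite leqnn => /(_ isT) Hn.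
have -> : rsum n F + F n.+1 - (rsum n G + G n.+1) =
  (rsum n F - rsum n G) + (F n.+1 - G n.+1) by lra.
by apply: Rle_trans (Rabs_triang _ _) _; lra.
Qed.

Lemma rsum_recl n F : rsum n.+1 F = F 1%N + \rsum_(k <= n) F k.+1.
Proof.
elim: n => [|n IHn]; first by rewrite /=; lra.
by rewrite [LHS]/= -/(rsum n.+1 F) IHn /=; lra.
Qed.

Lemma rsum_exchange m n (F : nat -> nat -> R) :
  \rsum_(i <= m) \rsum_(j <= n) F i j = \rsum_(j <= n) \rsum_(i <= m) F i j.
Proof.
elim: m => /= [|m ->]; last by rewrite rsumD.
by rewrite rsum_const; lra.
Qed.

Lemma rsum_widen m n F : (m <= n)%N ->
  (forall i, (m < i <= n)%N -> F i = 0) -> rsum n F = rsum m F.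
Proof.
elim: n => [|n IHn]; first by rewrite leqn0 => /eqP ->.
rewrite leq_eqVlt => /orP[/eqP -> // | lt_mn] F0 /=.
rewrite IHn // ?F0 ?leqnn ?lt_mn //; first lra.
by move=> i /andP[lt_mi le_in]; apply: F0; rewrite lt_mi leqW.
Qed.

Lemma rsum_ind_leq m n F : (m <= n)%N ->
  \rsum_(i <= n) (ind (i <= m)%N * F i) = rsum m F.
Proof.
move=> le_mn; rewrite (@rsum_widen m) //.
  by apply: eq_rsum => i /andP[_ ->]; rewrite /ind; lra.
by move=> i /andP[lt_mi _]; rewrite leqNgt lt_mi /ind /=; lra.
Qed.

Lemma rsum_le_widen m n F : (m <= n)%N ->
  (forall i, (m < i <= n)%N -> 0 <= F i) -> rsum m F <= rsum n F.
Proof.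
elim: n => [|n IHn]; first by rewrite leqn0 => /eqP ->; lra.
rewrite leq_eqVlt => /orP[/eqP -> | lt_mn] F0; first lra.
have H1 : rsum m F <= rsum n F.
  apply: IHn => // i /andP[lt_mi le_in]; apply: F0.
  by rewrite lt_mi leqW.
by have := F0 n.+1; rewrite leqnn lt_mn => /(_ isT) /=; lra.
Qed.

Lemma rsum_pick n j F : (0 < j <= n)%N ->
  \rsum_(i <= n) (ind (i == j) * F i) = F j.
Proof.
elim: n => [|n IHn] /=; first lia.
case: (eqVneq n.+1 j) => [<- _|neq_nj /andP[j0 le_jn]].
  rewrite (@eq_rsum _ _ (fun=> 0)) ?rsum_const /ind; first lra.
  by move=> i ?; rewrite ifF; [lra | apply/eqP; lia].
by rewrite IHn /ind; [lra | lia].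
Qed.

Lemma rsum_multiples M f F : (0 < f)%N ->
  \rsum_(m <= M) (ind (f %| m) * F m) = \rsum_(k <= M %/ f) F (f * k)%N.
Proof.
move=> f0; elim: M => [|M IHM]; first by rewrite div0n.
rewrite [LHS]/= IHM divnS //; case dv: (f %| M.+1).
  rewrite add1n /= /ind; suff -> : (f * (M %/ f).+1 = M.+1)%N by lra.
  by rewrite -[in RHS](divnK dv) mulnC divnS // dv.
by rewrite add0n /ind; lra.
Qed.

(** * Counting by explicit bijections *)

Lemma size_bij (T1 T2 : eqType) (s1 : seq T1) (s2 : seq T2)
    (phi : T1 -> T2) (psi : T2 -> T1) :
  uniq s1 -> uniq s2 ->
  (forall x, x \in s1 -> phi x \in s2 /\ psi (phi x) = x) ->
  (forall y, y \in s2 -> psi y \in s1 /\ phi (psi y) = y) ->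
  size s1 = size s2.
Proof.
move=> u1 u2 H12 H21; apply/eqP; rewrite eqn_leq; apply/andP; split.
  rewrite -(size_map phi); apply: uniq_leq_size.
    rewrite map_inj_in_uniq // => x y /H12[_ ex] /H12[_ ey] eq_xy.
    by rewrite -ex eq_xy.
  by move=> _ /mapP[x /H12[Hx _] ->].
rewrite -(size_map psi); apply: uniq_leq_size.
  rewrite map_inj_in_uniq // => x y /H21[_ ex] /H21[_ ey] eq_xy.
  by rewrite -ex eq_xy.
by move=> _ /mapP[x /H21[Hx _] ->].
Qed.

Lemma rsum_ind_count n p :
  \rsum_(i <= n) ind (p i) = INR (count p (iota 1 n))%N.
Proof.
elim: n => // n IHn; rewrite -addn1 iotaD count_cat plus_INR -IHn addn1 /=.
by rewrite add1n addn0; case: (p n.+1); rewrite /ind /=; lra.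
Qed.

Lemma rsum_bij n m (p q : pred nat) (phi psi : nat -> nat) :
  (forall x, (0 < x <= n)%N -> p x ->
     [/\ (0 < phi x <= m)%N, q (phi x) & psi (phi x) = x]) ->
  (forall y, (0 < y <= m)%N -> q y ->
     [/\ (0 < psi y <= n)%N, p (psi y) & phi (psi y) = y]) ->
  \rsum_(i <= n) ind (p i) = \rsum_(i <= m) ind (q i).
Proof.
move=> H1 H2; rewrite !rsum_ind_count -!size_filter.
congr INR; apply: (size_bij (phi := phi) (psi := psi)).
- by rewrite filter_uniq ?iota_uniq.
- by rewrite filter_uniq ?iota_uniq.
- move=> x; rewrite !mem_filter !mem_iota !add1n !ltnS => /andP[px rx].
  by have [-> ->] := H1 x rx px.
- move=> x; rewrite !mem_filter !mem_iota !add1n !ltnS => /andP[px rx].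
  by have [-> ->] := H2 x rx px.
Qed.

(** An explicit duplicate-free list, so that double sums of indicators can be compared by a
    bijection; the inner bound depends on [x] to allow hyperbolic regions. *)
Definition index_pairs a (b : nat -> nat) (p : nat -> nat -> bool) :=
  [seq (x, y) | x <- iota 1 a, y <- [seq y <- iota 1 (b x) | p x y]]%N.

Lemma mem_index_pairs a b p x y : ((x, y) \in index_pairs a b p) =
  [&& (0 < x <= a)%N, (0 < y <= b x)%N & p x y].
Proof.
apply/allpairsPdep/and3P => /= [[x' [y' [H1 H2 [-> ->]]]]|[rx ry pxy]].
  move: H1 H2; rewrite mem_filter !mem_iota !add1n !ltnS.
  by move=> -> /andP[-> ->].
by exists x, y; rewrite mem_filter !mem_iota !add1n !ltnS rx ry pxy.
Qed.

Lemma uniq_index_pairs a b p : uniq (index_pairs a b p).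
Proof.
apply: allpairs_uniq_dep; first exact: iota_uniq.
  by move=> x _; rewrite filter_uniq ?iota_uniq.
by move=> [x y] [x' y'] _ _ /= [-> ->].
Qed.

Lemma rsum2_ind_size a b p :
  \rsum_(x <= a) \rsum_(y <= b x) ind (p x y) = INR (size (index_pairs a b p)).
Proof.
rewrite /index_pairs size_allpairs_dep; elim: a => // a IHa.
rewrite -addn1 iotaD map_cat sumn_cat plus_INR -IHa addn1 /=.
by rewrite rsum_ind_count add1n size_filter addn0.
Qed.

Lemma rsum2_bij a b p a' b' p' (phi psi : nat * nat -> nat * nat) :
  (forall u, u \in index_pairs a b p ->
     phi u \in index_pairs a' b' p' /\ psi (phi u) = u) ->
  (forall u, u \in index_pairs a' b' p' ->
     psi u \in index_pairs a b p /\ phi (psi u) = u) ->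
  \rsum_(x <= a) \rsum_(y <= b x) ind (p x y) =
  \rsum_(x <= a') \rsum_(y <= b' x) ind (p' x y).
Proof.
move=> H1 H2; rewrite !rsum2_ind_size; congr INR.
by apply: (size_bij _ _ H1 H2); apply: uniq_index_pairs.
Qed.

(** * Divisors up to the square root *)

Lemma INR_tau P : INR (tau P) = \rsum_(d <= P) ind (d %| P).
Proof.
rewrite rsum_ind_count /tau -size_filter; congr INR.
have -> : forall n a, List.seq a n = iota a n.
  by elim=> //= n IHn a; rewrite IHn.
rewrite -[LHS]/(size _); congr size.
(* The two remainders are identified by uniqueness of Euclidean division, which needs a positive
   divisor. *)
have : all (fun d => 0 < d)%N (iota 1 P).
  by apply/allP => d; rewrite mem_iota => /andP[].
elim: (iota 1 P) => //= d s IHs /andP[d0 s0]; rewrite IHs //.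
have <- : (P %% d)%N = Nat.modulo P d.
  apply: (Nat.mod_unique _ _ (P %/ d)); first by apply/ltP; rewrite ltn_mod.
  by rewrite {1}(divn_eq P d) mulnC.
by rewrite /dvdn; case: (P %% d)%N.
Qed.

Definition small_divisors h m := \rsum_(d <= m) ind (d %| m * (m + h))%N.

(** As [P = m (m + h)], the map [d -> P / d] exchanges the divisors [d <= m] with the divisors
    [d >= m + h]. Only those strictly between remain, fewer than the [h] integers of
    [(m, m + h]]. *)
Lemma tau_small_divisors h m : (0 < h)%N -> (0 < m)%N ->
  2 * small_divisors h m <= INR (tau (m * (m + h))) <=
  2 * small_divisors h m + INR h.
Proof.
move=> h0 m0; rewrite INR_tau /small_divisors; set P := (m * (m + h))%N.
have le_mhP : (m + h <= P)%N by rewrite leq_pmull.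
have le_mP : (m <= P)%N by apply: leq_trans le_mhP; rewrite leq_addr.
have P0 : (0 < P)%N by apply: leq_trans le_mP.
have lowE : \rsum_(d <= m) ind (d %| P) =
    \rsum_(d <= P) ind ((d %| P) && (d <= m))%N.
  rewrite -(rsum_ind_leq _ le_mP); apply: eq_rsum => d _.
  by rewrite ind_and; lra.
have highE : \rsum_(d <= m) ind (d %| P) =
    \rsum_(d <= P) ind ((d %| P) && (m + h <= d))%N.
  rewrite lowE; apply: (rsum_bij (phi := divn P) (psi := divn P)) => d _;
    case/andP=> /dvdnP[q PE] le_d; move: (P0); rewrite PE muln_gt0;
    case/andP=> q0 d0; rewrite mulnK // mulKn // leq_pmulr // q0;
    rewrite dvdn_mulr //=; split=> //.
  - by rewrite -(leq_pmul2r d0) -PE /P mulnC leq_mul2r le_d orbT.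
  - by rewrite -(leq_pmul2r d0) -PE /P leq_mul2l le_d orbT.
pose mid := \rsum_(d <= P) ind [&& d %| P, m < d & d < m + h]%N.
have mid0 : 0 <= mid by apply: rsum_ge0 => i _; apply: ind_ge0.
have mid1 : mid <= INR h.
  apply: (@Rle_trans _ (\rsum_(d <= P) (ind (d <= m + h)%N * 1 -
      ind (d <= m)%N * 1))).
    apply: rsum_le => d _; case: (d %| P); rewrite /ind /=.
      by case: (leqP d m) => ?; case: (ltnP d (m + h)) => ? //=;
        case: (leqP d (m + h)) => ? /=; lra || lia.
    by case: (leqP d m) => ?; case: (leqP d (m + h)) => ?; lra || lia.
  rewrite rsumB !rsum_ind_leq // !rsum_const plus_INR; lra.
suff -> : \rsum_(d <= P) ind (d %| P) =
    \rsum_(d <= m) ind (d %| P) + mid + \rsum_(d <= m) ind (d %| P) by lra.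
rewrite {2}highE lowE /mid -!rsumD.
apply: eq_rsum => d _; case: (d %| P) => /=; last by rewrite /ind; lra.
by case: (leqP d m) => ?; case: (leqP (m + h) d) => ?;
  rewrite /ind /=; lra || lia.
Qed.

(* The bijection sends [(g, e)] to [(f, d)] with [f = gcd (m / g, e)] and
   [d = g e / f]; backwards, [g = gcd (m / f, d)] and [e = f d / g]. *)
Lemma pairs_of_divisors h m : (0 < h)%N -> (0 < m)%N ->
  \rsum_(g <= m) \rsum_(e <= m %/ g) ind ((g %| m) && (e %| m + h))%N =
  \rsum_(f <= h) (ind (f %| h) * (ind (f %| m) *
    small_divisors (h %/ f) (m %/ f))).
Proof.
move=> h0 m0.
transitivity (\rsum_(f <= h) \rsum_(d <= m %/ f) ind [&& f %| h, f %| m &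
    d %| (m %/ f) * (m %/ f + h %/ f)]%N); last first.
  apply: eq_rsum => f _; rewrite -!rsumZ; apply: eq_rsum => d _.
  by rewrite !ind_and.
pose phi (u : nat * nat) := let f := gcdn (m %/ u.1) u.2 in
  (f, (u.1 * u.2) %/ f)%N.
pose psi (u : nat * nat) := let g := gcdn (m %/ u.1) u.2 in
  (g, u.1 * (u.2 %/ g))%N.
apply: (rsum2_bij (phi := phi) (psi := psi)).
- case=> g e; rewrite !mem_index_pairs.
  case/and3P=> /andP[g0 le_gm] /andP[e0 le_e] /andP[dvd_g dvd_e].
  move: le_e; set m1 := (m %/ g)%N => le_e.
  have m1E : (m = g * m1)%N by rewrite mulnC divnK.
  rewrite /phi /psi /= -/m1; set f := gcdn m1 e.
  have f0 : (0 < f)%N by rewrite gcdn_gt0 e0 orbT.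
  have [a aE] : exists a, m1 = (f * a)%N.
    by exists (m1 %/ f)%N; rewrite mulnC divnK ?dvdn_gcdl.
  have [b bE] : exists b, e = (f * b)%N.
    by exists (e %/ f)%N; rewrite mulnC divnK ?dvdn_gcdr.
  have cop : gcdn a b = 1%N.
    apply/eqP; rewrite -(eqn_pmul2l f0) muln1 muln_gcdr -aE -bE.
    by rewrite -/f.
  have mE : (m = f * (g * a))%N by rewrite m1E aE mulnCA.
  (* [f] divides [m] through [m1] and [m + h] through [e], hence their difference. *)
  have dvd_fh : (f %| h)%N.
    have := dvdn_trans (dvdn_gcdr m1 e) dvd_e; rewrite -/f dvdn_addr //.
    by rewrite mE dvdn_mulr.
  have [h1 hE] : exists h1, h = (f * h1)%N.
    by exists (h %/ f)%N; rewrite mulnC divnK.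
  have ->: (g * e %/ f = g * b)%N by rewrite bE mulnCA mulKn.
  have ->: (m %/ f = g * a)%N by rewrite mE mulKn.
  have ->: (h %/ f = h1)%N by rewrite hE mulKn.
  rewrite -muln_gcdr cop muln1 mulKn // -bE; split=> //.
  rewrite f0 dvdn_leq // dvd_fh {1}mE dvdn_mulr //=.
  rewrite muln_gt0 g0 leq_mul2l -mulnA dvdn_pmul2l //.
  have b0 : (0 < b)%N by move: e0; rewrite bE; case: (b); rewrite ?muln0.
  rewrite b0 -(leq_pmul2l f0) -aE -bE le_e orbT /=.
  rewrite dvdn_mull // -(dvdn_pmul2l f0) -bE mulnDr -mE.
  by rewrite -hE.
- case=> f d; rewrite !mem_index_pairs.
  case/and3P=> /andP[f0 le_fh] /andP[d0 le_d] /and3P[dvd_fh dvd_fm dvd_d].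
  have [h1 hE] : exists h1, h = (f * h1)%N.
    by exists (h %/ f)%N; rewrite mulnC divnK.
  have hfE : (h %/ f = h1)%N by rewrite hE mulKn.
  move: le_d dvd_d; rewrite hfE.
  set m1 := (m %/ f)%N => le_d dvd_d.
  have m1E : (m = f * m1)%N by rewrite mulnC divnK.
  rewrite /phi /psi /= -/m1; set g := gcdn m1 d.
  have g0 : (0 < g)%N by rewrite gcdn_gt0 d0 orbT.
  have [a aE] : exists a, m1 = (g * a)%N.
    by exists (m1 %/ g)%N; rewrite mulnC divnK ?dvdn_gcdl.
  have [b bE] : exists b, d = (g * b)%N.
    by exists (d %/ g)%N; rewrite mulnC divnK ?dvdn_gcdr.
  have cop : gcdn a b = 1%N.
    apply/eqP; rewrite -(eqn_pmul2l g0) muln1 muln_gcdr -aE -bE.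
    by rewrite -/g.
  have mE : (m = g * (f * a))%N by rewrite m1E aE mulnCA.
  have ->: (d %/ g = b)%N by rewrite bE mulKn.
  have ->: (m %/ g = f * a)%N by rewrite mE mulKn.
  rewrite -muln_gcdr cop muln1 (mulnCA g) mulKn // -bE; split=> //.
  have dvd_gm : (g %| m)%N by rewrite mE dvdn_mulr.
  have b0 : (0 < b)%N by move: d0; rewrite bE; case: (b); rewrite ?muln0.
  rewrite g0 dvd_gm dvdn_leq // muln_gt0 f0 b0 leq_mul2l.
  rewrite -(leq_pmul2l g0) -aE -bE le_d orbT /=.
  rewrite m1E hE -mulnDr dvdn_pmul2l //.
  (* From [g b | g a (m1 + h1)] and [b] coprime to [a] follows [b | m1 + h1], which is [e | m + h]
     after cancelling [f]. *)
  move: dvd_d; rewrite {1}aE bE -mulnA dvdn_pmul2l // Gauss_dvdr //.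
  by rewrite coprime_sym /coprime cop.
Qed.

Definition small_sum h M := \rsum_(m <= M) small_divisors h m.

(** [F_h(M)] with [m = g y] substituted: the condition [g e <= m] becomes [e <= y]. *)
Definition lattice_count h M :=
  \rsum_(g <= M) \rsum_(e <= M %/ g)
    \rsum_(y <= M %/ g) ind ((e <= y) && (e %| g * y + h))%N.

(** [pairs_of_divisors] summed over [m]. On the left [m] runs over the multiples [g y]; on the
    right, for each [f], over the multiples [f k]. *)
Lemma lattice_countE h M : (0 < h)%N ->
  lattice_count h M =
  \rsum_(f <= h) (ind (f %| h) * small_sum (h %/ f) (M %/ f)).
Proof.
move=> h0; transitivity (\rsum_(m <= M) \rsum_(g <= m) \rsum_(e <= m %/ g)
    ind ((g %| m) && (e %| m + h))%N).
  transitivity (\rsum_(m <= M) \rsum_(g <= M) \rsum_(e <= m %/ g)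
    ind ((g %| m) && (e %| m + h))%N); last first.
    apply: eq_rsum => m /andP[m0 le_mM]; apply: (@rsum_widen m) => //.
    by move=> g /andP[lt_mg _]; rewrite divn_small.
  rewrite rsum_exchange; apply: eq_rsum => g /andP[g0 le_gM].
  transitivity (\rsum_(m <= M) (ind (g %| m) *
    \rsum_(e <= m %/ g) ind (e %| m + h)%N)); last first.
    apply: eq_rsum => m _; rewrite -rsumZ; apply: eq_rsum => e _.
    by rewrite ind_and.
  rewrite rsum_multiples // rsum_exchange; apply: eq_rsum => y /andP[y0 le_y].
  rewrite mulKn // -(rsum_ind_leq _ le_y); apply: eq_rsum => e _.
  by rewrite ind_and.
transitivity (\rsum_(m <= M) \rsum_(f <= h) (ind (f %| h) * (ind (f %| m) *
    small_divisors (h %/ f) (m %/ f)))).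
  by apply: eq_rsum => m /andP[m0 _]; rewrite pairs_of_divisors.
rewrite rsum_exchange; apply: eq_rsum => f /andP[f0 _].
rewrite rsumZ rsum_multiples //; congr (_ * _).
by apply: eq_rsum => k _; rewrite mulKn.
Qed.

(** * Counting in residue classes *)

Definition harmonic n := \rsum_(k <= n) / INR k.

(** This is [V(X)]: the nested ranges describe [g e <= X]. Restricting to coprime pairs gives
    [W(X)], the next definition. *)
Definition hyperbola_sum X :=
  \rsum_(g <= X) \rsum_(e <= X %/ g) / (INR g * INR e).

Definition coprime_sum X :=
  \rsum_(g <= X) \rsum_(e <= X %/ g) (ind (coprime g e) * / (INR g * INR e)).

(** Pairs with gcd [d] are [(d g, d e)] with [g], [e] coprime, and the region [g e <= M] shrinks to
    [g e <= M / d^2]. The summand stays general because both [V] and the main term of the lattice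
    count are regrouped this way. *)
Lemma rsum_gcd_eq M d (phi : nat -> nat -> R) : (0 < d)%N ->
  \rsum_(g <= M) \rsum_(e <= M %/ g) (ind (gcdn g e == d) * phi g e) =
  \rsum_(g <= M %/ d ^ 2) \rsum_(e <= M %/ d ^ 2 %/ g)
    (ind (coprime g e) * phi (d * g)%N (d * e)%N).
Proof.
move=> d0; transitivity (\rsum_(g <= M) (ind (d %| g) * \rsum_(e <= M %/ g)
    (ind (d %| e) * (ind (gcdn g e == d) * phi g e)))).
  apply: eq_rsum => g _; rewrite -rsumZ; apply: eq_rsum => e _.
  case: (eqVneq (gcdn g e) d) => [<-|_]; last by rewrite /ind; lra.
  by rewrite dvdn_gcdl dvdn_gcdr /ind; lra.
rewrite rsum_multiples //.
have le_dd : (M %/ d ^ 2 <= M %/ d)%N.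
  by rewrite -mulnn divnMA leq_div.
(* For [g > M / d^2] the inner range is empty. *)
rewrite (rsum_widen le_dd); last first.
  move=> g /andP[lt_g _]; rewrite rsum_multiples // -divnMA mulnAC mulnn.
  by rewrite divnMA divn_small.
apply: eq_rsum => g _; rewrite rsum_multiples // -divnMA mulnAC mulnn.
rewrite divnMA; apply: eq_rsum => e _.
by rewrite -muln_gcdr -{2}[d]muln1 eqn_pmul2l.
Qed.

Lemma hyperbola_sumE X :
  hyperbola_sum X = \rsum_(d <= X) (/ INR d ^ 2 * coprime_sum (X %/ d ^ 2)).
Proof.
transitivity (\rsum_(d <= X) \rsum_(g <= X) \rsum_(e <= X %/ g)
    (ind (gcdn g e == d) * / (INR g * INR e))).
  rewrite rsum_exchange; apply: eq_rsum => g /andP[g0 le_gX].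
  rewrite rsum_exchange; apply: eq_rsum => e _.
  rewrite -[LHS](@rsum_pick X (gcdn g e) (fun=> / (INR g * INR e))).
    by apply: eq_rsum => d _; rewrite eq_sym.
  by rewrite gcdn_gt0 g0 (leq_trans _ le_gX) // dvdn_leq // dvdn_gcdl.
apply: eq_rsum => d /andP[d0 _].
rewrite (rsum_gcd_eq _ (fun g e => / (INR g * INR e))) // -rsumZ.
apply: eq_rsum => g /andP[/INR_gt0 g0 _]; rewrite -rsumZ.
apply: eq_rsum => e /andP[/INR_gt0 e0 _].
have {}d0 := INR_gt0 d0.
rewrite !mult_INR; set i := ind _; field; lra.
Qed.

Lemma rsum_shift s K F :
  rsum (K + s) F = rsum s F + \rsum_(y <= K) F (y + s)%N.
Proof.
elim: K => [|K IHK]; first by rewrite add0n /=; lra.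
by rewrite addSn [LHS]/= IHK /= addSn; lra.
Qed.

(** * Counting solutions of a linear congruence *)

Lemma rsum_ind_dvdn e n : (0 < e)%N ->
  \rsum_(x <= n) ind (e %| x) = INR (n %/ e).
Proof.
move=> e0; rewrite -[RHS]Rmult_1_r -rsum_const.
rewrite -(@rsum_multiples n e (fun=> 1)) //.
by apply: eq_rsum => x _; lra.
Qed.

(** Choose [a] with [a g = -1] and [s = - a h] modulo [e]. Then [a (g y + h) + (y + s)] is divisible
    by [e], so [y] is a solution exactly when [e | y + s]. Since [s < e], no multiple of [e] lies in
    [[1, s]], and the count is that of the multiples up to [K + s]. *)
Lemma linear_congruence_count g e h : (0 < e)%N -> coprime g e ->
  exists2 s, (s < e)%N &
    forall K, \rsum_(y <= K) ind (e %| g * y + h)%N = INR ((K + s) %/ e).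
Proof.
move=> e0 co_ge; have [a _] := Bezoutl g e0.
rewrite gcdnC (eqP co_ge) => dvd_e1.
have co_ea : coprime e a.
  rewrite /coprime -dvdn1; have := dvdn_trans (dvdn_gcdl e a) dvd_e1.
  by rewrite dvdn_addl // dvdn_mulr // dvdn_gcdr.
pose s := ((e - (a * h) %% e) %% e)%N.
have lt_se : (s < e)%N by rewrite ltn_mod.
have dvd_s : (e %| a * h + s)%N.
  rewrite /dvdn -modnDml modnDmr subnKC ?modnn //.
  by rewrite ltnW // ltn_mod.
exists s => // K.
rewrite -rsum_ind_dvdn // rsum_shift [X in X + _](@eq_rsum _ _ (fun=> 0)).
  rewrite rsum_const Rmult_0_r Rplus_0_l; apply: eq_rsum => y _; congr ind.
  rewrite -(Gauss_dvdr _ co_ea).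
  have : (e %| a * (g * y + h) + (y + s))%N.
    rewrite (_ : _ + _ = (1 + a * g) * y + (a * h + s))%N; last first.
      by rewrite mulnDr mulnDl mul1n mulnA; lia.
    by rewrite dvdn_add // dvdn_mulr.
  move=> dvd_sum; apply/idP/idP => H.
    by rewrite -(dvdn_addr _ H).
  by rewrite -(dvdn_addl _ H).
move=> x /andP[x0 le_xs]; rewrite gtnNdvd //.
exact: leq_ltn_trans le_xs lt_se.
Qed.

Lemma INR_divn m d : (0 < d)%N ->
  INR m / INR d - 1 < INR (m %/ d) <= INR m / INR d.
Proof.
move=> d0; have dR := INR_gt0 d0; have dN0 : INR d <> 0 by lra.
have := lt_INR _ _ (ltP (ltn_ceil m d0)); rewrite mult_INR S_INR => H1.
have := ler_INR (leq_divM m d); rewrite mult_INR => H2.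
have mE : INR m = INR m / INR d * INR d by field.
by move: (INR m / INR d) mE H1 H2 => q ->; split; nra.
Qed.

(** If [d = gcd (g, e)] does not divide [h] there is no solution. Otherwise dividing by [d] leaves a
    congruence modulo [e1 = e / d] with unit coefficient, hence about [(M / g) / e1] solutions. The
    excluded [y < e] contain at most [d + 1] of them, [d <= h], and rounding accounts for the rest
    of the error. *)
Lemma congruence_count_dist M g e h : (0 < h)%N -> (0 < g)%N ->
  (0 < e <= M %/ g)%N ->
  Rabs (\rsum_(y <= M %/ g) ind ((e <= y) && (e %| g * y + h))%N -
        ind (gcdn g e %| h) * (INR M * INR (gcdn g e) / (INR g * INR e)))
  <= INR h + 3.
Proof.
move=> h0 g0 /andP[e0 le_e]; have hR := pos_INR h.
set d := gcdn g e; have d0 : (0 < d)%N by rewrite gcdn_gt0 g0.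
case: (boolP (d %| h)) => [dvd_dh|ndvd_dh]; last first.
  rewrite (@eq_rsum _ _ (fun=> 0)) ?rsum_const /ind.
    by rewrite (_ : _ - _ = 0) ?Rabs_R0; lra.
  move=> y _; case: ifP => // /andP[_ dvd_e]; case/negP: ndvd_dh.
  rewrite -(dvdn_addr h (_ : d %| g * y))%N ?dvdn_mulr ?dvdn_gcdl //.
  exact: dvdn_trans (dvdn_gcdr g e) dvd_e.
have [g1 gE] : exists g1, g = (d * g1)%N.
  by exists (g %/ d)%N; rewrite mulnC divnK ?dvdn_gcdl.
have [e1 eE] : exists e1, e = (d * e1)%N.
  by exists (e %/ d)%N; rewrite mulnC divnK ?dvdn_gcdr.
have [h1 hE] : exists h1, h = (d * h1)%N.
  by exists (h %/ d)%N; rewrite mulnC divnK.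
have co1 : coprime g1 e1.
  by rewrite /coprime -(eqn_pmul2l d0) muln_gcdr -gE -eE muln1.
have e10 : (0 < e1)%N by move: e0; rewrite eE muln_gt0 d0.
have dvdE y : (e %| g * y + h)%N = (e1 %| g1 * y + h1)%N.
  by rewrite [in LHS]gE [in LHS]eE [in LHS]hE -mulnA -mulnDr dvdn_pmul2l.
have [s lt_se cntE] := linear_congruence_count h1 e10 co1.
have -> : \rsum_(y <= M %/ g) ind ((e <= y) && (e %| g * y + h))%N =
   INR ((M %/ g + s) %/ e1) - INR ((e.-1 + s) %/ e1).
  have le_e' : (e.-1 <= M %/ g)%N by lia.
  rewrite -!cntE -(rsum_ind_leq _ le_e') -rsumB; apply: eq_rsum => y _.
  rewrite dvdE; case: (e1 %| _)%N; rewrite ?andbT ?andbF /ind; last lra.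
  by case: (leqP e y) => ?; case: (leqP y e.-1) => ?; lra || lia.
have le_dh : INR d <= INR h by apply: ler_INR; apply: dvdn_leq.
have [M1 M2] := INR_divn M g0.
have [A1 A2] := INR_divn (M %/ g + s) e10.
have [B1 B2] := INR_divn (e.-1 + s) e10.
have e1R := INR_gt0 e10; have gR := INR_gt0 g0; have dR := INR_gt0 d0.
have e1R1 : 1 <= INR e1 by apply: (@ler_INR 1).
have sR : 0 <= INR s <= INR e1 - 1.
  split; first exact: pos_INR.
  by have := ler_INR lt_se; rewrite S_INR; lra.
have eRE : INR e = INR d * INR e1 by rewrite [in LHS]eE mult_INR.
have eR : INR e.-1 = INR d * INR e1 - 1.
  by rewrite -eRE -[in RHS](prednK e0) S_INR; lra.
have mainE : INR M * INR d / (INR g * INR e) = INR M / INR g * / INR e1.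
  by rewrite eRE; field; lra.
rewrite mainE (_ : ind true = 1) // Rmult_1_l.
set x := INR M / INR g in M1 M2 *.
have i1 : 0 < / INR e1 <= 1.
  split; first exact: Rinv_0_lt_compat.
  by rewrite -Rinv_1; apply: Rinv_le_contravar; lra.
have iK : INR e1 * / INR e1 = 1 by field; lra.
move: A1 A2 B1 B2; rewrite !plus_INR eR /Rdiv; set k := INR (M %/ g) in M1 M2 *.
set i := / INR e1 in i1 iK *.
move=> A1 A2 B1 B2.
have C1 : INR s * i <= 1 - i by nra.
have C2 : 0 <= INR s * i by nra.
have C3 : (INR d * INR e1 - 1 + INR s) * i <= INR d + 1 - 2 * i.
  rewrite (_ : _ * i = INR d * (INR e1 * i) - i + INR s * i); last by ring.
  by rewrite iK; lra.
have C4 : 0 <= INR ((e.-1 + s) %/ e1) by exact: pos_INR.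
have C5 : (k + INR s) * i <= x * i + 1 by nra.
have C6 : x * i - 1 <= (k + INR s) * i by nra.
by apply: Rabs_le; lra.
Qed.

(** The main terms [M d / (g e)] are grouped by [d = gcd (g, e)]; rescaling the pair by [d] turns
    them into [M / d] times a coprime sum up to [M / d^2]. The error [h + 3] occurs once per pair
    with [g e <= M], and there are at most [M * harmonic M] such pairs. *)
Lemma lattice_count_dist h M : (0 < h)%N ->
  Rabs (lattice_count h M - INR M * \rsum_(d <= h)
          (ind (d %| h) * (/ INR d * coprime_sum (M %/ d ^ 2))))
  <= (INR h + 3) * (INR M * harmonic M).
Proof.
move=> h0.
have -> : (INR M * \rsum_(d <= h)
    (ind (d %| h) * (/ INR d * coprime_sum (M %/ d ^ 2)))) =
  \rsum_(g <= M) \rsum_(e <= M %/ g)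
    (ind (gcdn g e %| h) * (INR M * INR (gcdn g e) / (INR g * INR e))).
  transitivity (\rsum_(d <= h) \rsum_(g <= M) \rsum_(e <= M %/ g)
     (ind (gcdn g e == d) *
       (ind (d %| h) * (INR M * INR d / (INR g * INR e))))).
    rewrite -rsumZ; apply: eq_rsum => d /andP[d0 _].
    rewrite (rsum_gcd_eq _ (fun g e => ind (d %| h) *
       (INR M * INR d / (INR g * INR e)))) // -!rsumZ.
    have {}d0 := INR_gt0 d0.
    apply: eq_rsum => g /andP[/INR_gt0 g0 _]; rewrite -!rsumZ.
    apply: eq_rsum => e /andP[/INR_gt0 e0 _].
    rewrite !mult_INR; set i := ind (coprime _ _); set j := ind _.
    by field; lra.
  rewrite rsum_exchange; apply: eq_rsum => g /andP[g0 le_gM].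
  rewrite rsum_exchange; apply: eq_rsum => e _.
  case: (boolP (gcdn g e %| h)) => [dvd_h|ndvd_h].
    transitivity (\rsum_(d <= h) (ind (d == gcdn g e) *
       (ind (d %| h) * (INR M * INR d / (INR g * INR e))))).
      by apply: eq_rsum => d _; rewrite eq_sym.
    rewrite rsum_pick ?dvd_h //.
    by rewrite gcdn_gt0 g0 (dvdn_leq h0 dvd_h).
  rewrite (@eq_rsum _ _ (fun=> 0)) ?rsum_const; first by rewrite /ind; lra.
  move=> d _; case: (eqVneq (gcdn g e) d) => [<-|_]; last by rewrite /ind; lra.
  by rewrite (negbTE ndvd_h) /ind; lra.
apply: Rle_trans (_ : \rsum_(g <= M) \rsum_(e <= M %/ g) (INR h + 3) <= _).
  apply: rsum_dist_le => g /andP[g0 _]; apply: rsum_dist_le => e re.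
  exact: congruence_count_dist.
rewrite /harmonic -!rsumZ; apply: rsum_le => g /andP[g0 _].
rewrite rsum_const; have [_ H] := INR_divn M g0; have hR := pos_INR h.
by rewrite Rmult_comm; apply: Rmult_le_compat_l => //; lra.
Qed.

(** * Harmonic sums *)

Lemma ln_le_sub1 x : 0 < x -> ln x <= x - 1.
Proof. by move=> x0; have := exp_ineq1_le (ln x); rewrite exp_ln //; lra. Qed.

Lemma ln_succ n : (0 < n)%N ->
  / INR n.+1 <= ln (INR n.+1) - ln (INR n) <= / INR n.
Proof.
move=> /INR_gt0 n0; rewrite S_INR -ln_div; try lra; split.
  have := @ln_le_sub1 (INR n / (INR n + 1)).
  rewrite !ln_div; try lra.
  have -> : INR n / (INR n + 1) - 1 = - / (INR n + 1) by field; lra.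
  by move=> H; have := H _; (suff: 0 < INR n / (INR n + 1) by lra);
     apply: Rdiv_lt_0_compat; lra.
have -> : (INR n + 1) / INR n = 1 + / INR n by field; lra.
have := Rinv_0_lt_compat _ n0 => i0.
by have := @ln_le_sub1 (1 + / INR n); lra.
Qed.

Lemma harmonicS n : harmonic n.+1 = harmonic n + / INR n.+1.
Proof. by []. Qed.

Lemma harmonic_ln n : (0 < n)%N ->
  ln (INR n) <= harmonic n <= 1 + ln (INR n).
Proof.
(* The lower bound is strengthened to [ln (n + 1)]: with [ln n] the induction step would fail. *)
move=> n0; have [H1 H2] : ln (INR n.+1) <= harmonic n <= 1 + ln (INR n).
  case: n n0 => // n _; elim: n => [|n [IH1 IH2]].
    rewrite /harmonic /= Rinv_1 ln_1; split; last lra.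
    by have := @ln_le_sub1 (1 + 1); lra.
  rewrite harmonicS.
  by have := @ln_succ n.+1 isT; have := @ln_succ n.+2 isT; lra.
split=> //; apply: Rle_trans H1; apply: ln_le; first exact: INR_gt0.
exact: ler_INR.
Qed.

Lemma harmonic_ge0 n : 0 <= harmonic n.
Proof.
apply: rsum_ge0 => k /andP[/INR_gt0 k0 _].
by left; apply: Rinv_0_lt_compat.
Qed.

(** The quotient [q = X %/ g] is at least 1, so [X / g < q + 1 <= 2 q], and [ln 2 <= 1]. *)
Lemma ln_divn X g : (0 < g <= X)%N ->
  ln (INR X) - ln (INR g) - 1 <= ln (INR (X %/ g)) <= ln (INR X) - ln (INR g).
Proof.
move=> /andP[g0 le_gX]; have q0 : (0 < X %/ g)%N by rewrite divn_gt0.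
have X0 : (0 < X)%N := leq_trans g0 le_gX.
have [H1 H2] := INR_divn X g0.
have qR : 1 <= INR (X %/ g) by apply: (@ler_INR 1).
move: H1 H2 qR; set q := INR (X %/ g) => H1 H2 qR.
rewrite -ln_div; try exact: INR_gt0.
split; last by apply: ln_le; lra.
have ln2 : ln 2 <= 1 by have := @ln_le_sub1 2; lra.
suff : ln (INR X / INR g) <= ln (2 * q) by rewrite ln_mult; lra.
by apply: ln_le; [apply: Rdiv_lt_0_compat; apply: INR_gt0 | lra].
Qed.

(** Summation by parts: the square of [harmonic k] grows by [2 * harmonic k / k - 1 / k^2] at step
    [k]. *)
Lemma rsum_harmonic n :
  \rsum_(k <= n) (/ INR k * harmonic k) =
  / 2 * (harmonic n ^ 2 + \rsum_(k <= n) / INR k ^ 2).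
Proof.
elim: n => [|n IHn]; first by rewrite /harmonic /=; lra.
have n0 : INR n.+1 <> 0 by apply: not_0_INR.
rewrite /rsum -/rsum IHn harmonicS; field.
exact: n0.
Qed.

(** The inner sum is [harmonic (X / g) / g]. Comparison with logarithms puts [harmonic (X / g)]
    within 2 of [harmonic X - harmonic g], and the sum of the latter over [g], weighted by [1 / g],
    is given by [rsum_harmonic]. *)
Lemma hyperbola_sum_dist X : (0 < X)%N ->
  Rabs (hyperbola_sum X - harmonic X ^ 2 / 2) <= 4 * harmonic X.
Proof.
move=> X0; set H := harmonic X.
have VE : hyperbola_sum X = \rsum_(g <= X) (/ INR g * harmonic (X %/ g)).
  apply: eq_rsum => g _; rewrite -rsumZ; apply: eq_rsum => e _.
  by rewrite Rinv_mult.
have D1 : Rabs (hyperbola_sum X -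
    \rsum_(g <= X) (/ INR g * (H - harmonic g))) <= 2 * H.
  rewrite VE {2}/H /harmonic -rsumZ; apply: rsum_dist_le => g rg.
  have /andP[g0 le_gX] := rg.
  have i0 : 0 < / INR g by apply: Rinv_0_lt_compat; exact: INR_gt0.
  have q0 : (0 < X %/ g)%N by rewrite divn_gt0.
  rewrite -Rmult_minus_distr_l Rabs_mult Rabs_right; last lra.
  rewrite Rmult_comm; apply: Rmult_le_compat_r; first lra.
  have := harmonic_ln X0; have := harmonic_ln g0; have := harmonic_ln q0.
  rewrite -/H -/(harmonic g) -/(harmonic (X %/ g)).
  by have := ln_divn rg => *; apply: Rabs_le; lra.
have D2 : \rsum_(g <= X) (/ INR g * (H - harmonic g)) =
    H ^ 2 / 2 - / 2 * \rsum_(k <= X) / INR k ^ 2.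
  rewrite (@eq_rsum _ _ (fun g => H * / INR g - / INR g * harmonic g)).
    by rewrite rsumB rsumZ rsum_harmonic -/H -/(harmonic X) -/H; lra.
  by move=> g _; lra.
have D3 : 0 <= \rsum_(k <= X) / INR k ^ 2 <= H.
  split; [apply: rsum_ge0|apply: rsum_le] => k /andP[k0 _];
    have kR := INR_gt0 k0.
    by left; apply: Rinv_0_lt_compat; apply: pow_lt.
  apply: Rinv_le_contravar => //; have : 1 <= INR k by apply: (@ler_INR 1).
  by move=> ?; nra.
have H0 : 0 <= H by exact: harmonic_ge0.
move: D1; rewrite D2 => /Rabs_le_between D1.
by apply: Rabs_le; lra.
Qed.

(** * Limits of logarithms, harmonic sums and [hyperbola_sum] *)

Lemma is_lim_seq_ln_INR : is_lim_seq (fun n => ln (INR n)) p_infty.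
Proof.
apply: (is_lim_comp_seq _ _ p_infty p_infty); first exact: is_lim_ln_p.
  by exists 0%N.
exact: is_lim_seq_INR.
Qed.

Lemma is_lim_seq_inv_ln_INR : is_lim_seq (fun n => / ln (INR n)) 0.
Proof. by have := is_lim_seq_inv _ _ is_lim_seq_ln_INR; apply. Qed.

Lemma ln_INR_gt0 n : (1 < n)%N -> 0 < ln (INR n).
Proof.
move=> n1; rewrite -ln_1; apply: ln_increasing; first lra.
exact: (lt_INR 1 n (ltP n1)).
Qed.

Lemma is_lim_seq_harmonic :
  is_lim_seq (fun n => harmonic n / ln (INR n)) 1.
Proof.
apply: (@is_lim_seq_le_le_loc (fun=> 1) _ (fun n => 1 + / ln (INR n))).
- exists 2%N => n /leP n2; have L0 := ln_INR_gt0 n2.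
  have := harmonic_ln (ltnW n2) => H.
  have -> : 1 = ln (INR n) / ln (INR n) by field; lra.
  have -> : ln (INR n) / ln (INR n) + / ln (INR n) =
     (1 + ln (INR n)) / ln (INR n) by field; lra.
  have i0 := Rinv_0_lt_compat _ L0.
  by split; apply: Rmult_le_compat_r; lra.
- exact: is_lim_seq_const.
- rewrite -{2}(Rplus_0_r 1); apply: is_lim_seq_plus'.
    exact: is_lim_seq_const.
  exact: is_lim_seq_inv_ln_INR.
Qed.

Lemma is_lim_seq_eq (u : nat -> R) (l l' : R) :
  is_lim_seq u l -> l = l' -> is_lim_seq u l'.
Proof. by move=> ? <-. Qed.

Lemma is_lim_seq_squeeze (u v w : nat -> R) (l : R) :
  eventually (fun n => Rabs (u n - v n) <= w n) ->
  is_lim_seq v l -> is_lim_seq w 0 -> is_lim_seq u l.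
Proof.
move=> [N Nle] limv limw.
apply: (@is_lim_seq_le_le_loc (fun n => v n - w n) _ (fun n => v n + w n)).
- by exists N => n /Nle /Rabs_le_between; lra.
- by apply: is_lim_seq_eq (is_lim_seq_minus' _ _ _ _ limv limw) _; lra.
- by apply: is_lim_seq_eq (is_lim_seq_plus' _ _ _ _ limv limw) _; lra.
Qed.

Lemma is_lim_seq_hyperbola :
  is_lim_seq (fun n => hyperbola_sum n / ln (INR n) ^ 2) (1 / 2).
Proof.
have limH := is_lim_seq_harmonic.
apply: (@is_lim_seq_squeeze _
  (fun n => (harmonic n / ln (INR n)) * (harmonic n / ln (INR n)) * / 2)
  (fun n => 4 * ((harmonic n / ln (INR n)) * / ln (INR n)))).
- exists 2%N => n /leP n2; have L0 := ln_INR_gt0 n2.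
  have := hyperbola_sum_dist (ltnW n2); set H := harmonic n.
  set V := hyperbola_sum n.
  set L := ln (INR n) in L0 *; move=> D.
  have -> : V / L ^ 2 - H / L * (H / L) * / 2 = (V - H ^ 2 / 2) / L ^ 2.
    by field; lra.
  have -> : 4 * (H / L * / L) = (4 * H) / L ^ 2 by field; lra.
  have L2 : 0 < L ^ 2 by nra.
  rewrite Rabs_div; last lra.
  rewrite (Rabs_right (L ^ 2)); last lra.
  by apply: Rmult_le_compat_r => //; left; apply: Rinv_0_lt_compat.
- apply: is_lim_seq_eq (is_lim_seq_mult' _ _ _ _
    (is_lim_seq_mult' _ _ _ _ limH limH) (is_lim_seq_const (/ 2))) _; lra.
- apply: is_lim_seq_eq (is_lim_seq_mult' _ _ _ _ (is_lim_seq_const 4)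
    (is_lim_seq_mult' _ _ _ _ limH is_lim_seq_inv_ln_INR)) _; lra.
Qed.

(** * Rescaling and coprime pairs *)

Lemma is_lim_seq_rsum k (F : nat -> nat -> R) (l : nat -> R) :
  (forall i, (0 < i <= k)%N -> is_lim_seq (F i) (l i)) ->
  is_lim_seq (fun n => \rsum_(i <= k) F i n) (\rsum_(i <= k) l i).
Proof.
elim: k => [|k IHk] H /=; first exact: is_lim_seq_const.
apply: is_lim_seq_plus'; last by apply: H; rewrite leqnn.
by apply: IHk => i /andP[i0 le_ik]; apply: H; rewrite i0 leqW.
Qed.

Lemma rescale_infty (k : nat -> nat) (r : R) : 0 < r ->
  is_lim_seq (fun n => INR (k n) / INR n) r ->
  filterlim k eventually eventually.
Proof.
move=> r_gt0 lim_k.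
have kinf : is_lim_seq (fun n => INR (k n)) p_infty.
  apply: (@is_lim_seq_ext_loc (fun n => INR (k n) / INR n * INR n)).
    exists 1%N => n /leP /INR_gt0 n0; field; lra.
  apply: is_lim_seq_mult lim_k is_lim_seq_INR _.
  by apply: is_Rbar_mult_sym; apply: is_Rbar_mult_p_infty_pos.
move=> P [N PN]; have [N' HN'] := proj2 (is_lim_seq_spec _ _) kinf (INR N).
exists N' => n /HN' lt_Nk; apply: PN; apply: INR_le; lra.
Qed.

(** [ln (k n) = ln n + ln (k n / n)], where the last term converges to [ln r] and is negligible
    against [ln n]. *)
Lemma rescale_ln (k : nat -> nat) (r : R) : 0 < r ->
  is_lim_seq (fun n => INR (k n) / INR n) r ->
  is_lim_seq (fun n => ln (INR (k n)) / ln (INR n)) 1.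
Proof.
move=> r_gt0 lim_k; have k_infty := rescale_infty r_gt0 lim_k.
apply: (@is_lim_seq_ext_loc
  (fun n => 1 + ln (INR (k n) / INR n) * / ln (INR n))).
  have : eventually (fun n => (1 <= k n)%coq_nat).
    by apply: k_infty; exists 1%N.
  case=> N HN; exists (N + 2)%N => n le_n.
  have k0 : 0 < INR (k n) by apply: INR_gt0; apply/leP; apply: HN; lia.
  have n1 : (1 < n)%N by lia.
  have n0 := INR_gt0 (ltnW n1); have L0 := ln_INR_gt0 n1.
  by rewrite ln_div //; field; lra.
have c : is_lim_seq (fun n => ln (INR (k n) / INR n)) (ln r).
  apply: is_lim_seq_continuous lim_k.
  apply: derivable_continuous_pt; exists (/ r).
  exact: derivable_pt_lim_ln.
apply: is_lim_seq_eq (is_lim_seq_plus' _ _ _ _ (is_lim_seq_const 1)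
  (is_lim_seq_mult' _ _ _ _ c is_lim_seq_inv_ln_INR)) _; lra.
Qed.

(** Slow variation of the logarithm: the limit does not depend on [r]. With the normalisation
    [n (log n)^2] below, a factor [r] appears. *)
Lemma rescale_ln2 (k : nat -> nat) (r : R) (u : nat -> R) (l : R) :
  0 < r ->
  is_lim_seq (fun n => INR (k n) / INR n) r ->
  is_lim_seq (fun n => u n / ln (INR n) ^ 2) l ->
  is_lim_seq (fun n => u (k n) / ln (INR n) ^ 2) l.
Proof.
move=> r_gt0 lim_k; have k_infty := rescale_infty r_gt0 lim_k.
have lim_ln := rescale_ln r_gt0 lim_k.
move=> /(is_lim_seq_subseq _ _ _ k_infty) lim_uk.
apply: (@is_lim_seq_ext_loc (fun n => u (k n) / ln (INR (k n)) ^ 2 *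
   (ln (INR (k n)) / ln (INR n) * (ln (INR (k n)) / ln (INR n))))).
  have : eventually (fun n => (2 <= k n)%coq_nat).
    by apply: k_infty; exists 2%N.
  case=> N HN; exists (N + 2)%N => n le_n.
  have kL : 0 < ln (INR (k n)) by apply: ln_INR_gt0; apply/leP; apply: HN; lia.
  have L0 : 0 < ln (INR n) by apply: ln_INR_gt0; lia.
  by field; lra.
apply: is_lim_seq_eq (is_lim_seq_mult' _ _ _ _ lim_uk
  (is_lim_seq_mult' _ _ _ _ lim_ln lim_ln)) _; lra.
Qed.

Lemma rescale_nln2 (k : nat -> nat) (r : R) (u : nat -> R) (l : R) :
  0 < r ->
  is_lim_seq (fun n => INR (k n) / INR n) r ->
  is_lim_seq (fun n => u n / (INR n * ln (INR n) ^ 2)) l ->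
  is_lim_seq (fun n => u (k n) / (INR n * ln (INR n) ^ 2)) (r * l).
Proof.
move=> r_gt0 lim_k lim_u; have k_infty := rescale_infty r_gt0 lim_k.
have {}lim_u : is_lim_seq (fun n => (u n / INR n) / ln (INR n) ^ 2) l.
  by apply: is_lim_seq_ext lim_u => n; rewrite /Rdiv Rinv_mult; ring.
apply: (@is_lim_seq_ext_loc (fun n => INR (k n) / INR n *
   (u (k n) / INR (k n) / ln (INR n) ^ 2))).
  have : eventually (fun n => (1 <= k n)%coq_nat).
    by apply: k_infty; exists 1%N.
  case=> N HN; exists (N + 2)%N => n le_n.
  have k0 : 0 < INR (k n) by apply: INR_gt0; apply/leP; apply: HN; lia.
  have n0 : 0 < INR n by apply: INR_gt0; lia.
  have L0 : 0 < ln (INR n) by apply: ln_INR_gt0; lia.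
  by field; lra.
exact: is_lim_seq_mult' lim_k (rescale_ln2 r_gt0 lim_k lim_u).
Qed.

Lemma is_lim_seq_divn d : (0 < d)%N ->
  is_lim_seq (fun n => INR (n %/ d) / INR n) (/ INR d).
Proof.
move=> d0; have dR := INR_gt0 d0.
apply: (@is_lim_seq_squeeze _ (fun=> / INR d) (fun n => / INR n)).
- exists 1%N => n /leP /INR_gt0 n0; have [H1 H2] := INR_divn n d0.
  have i0 := Rinv_0_lt_compat _ n0.
  have -> : INR (n %/ d) / INR n - / INR d =
    (INR (n %/ d) - INR n / INR d) * / INR n by field; lra.
  rewrite Rabs_mult (Rabs_right (/ _)); last lra.
  rewrite -[X in _ <= X]Rmult_1_l; apply: Rmult_le_compat_r; first lra.
  by apply: Rabs_le; lra.
- exact: is_lim_seq_const.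
- by have := is_lim_seq_inv _ _ is_lim_seq_INR; apply.
Qed.

(** * Coprime pairs against all pairs *)

Lemma rsum_hyperbola_le X Y (phi : nat -> nat -> R) : (X <= Y)%N ->
  (forall g e, (0 < g)%N -> (0 < e)%N -> 0 <= phi g e) ->
  \rsum_(g <= X) \rsum_(e <= X %/ g) phi g e <=
  \rsum_(g <= Y) \rsum_(e <= Y %/ g) phi g e.
Proof.
move=> le_XY phi0.
apply: Rle_trans (_ : \rsum_(g <= X) \rsum_(e <= Y %/ g) phi g e <= _).
  apply: rsum_le => g /andP[g0 _]; apply: rsum_le_widen; first exact: leq_div2r.
  move=> e /andP[lt_e _]; apply: phi0 => //; exact: leq_ltn_trans lt_e.
apply: rsum_le_widen => // g /andP[lt_g _].
have g0 : (0 < g)%N by exact: leq_ltn_trans lt_g.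
by apply: rsum_ge0 => e /andP[e0 _]; apply: phi0.
Qed.

Lemma inv_mul_ge0 g e : (0 < g)%N -> (0 < e)%N -> 0 <= / (INR g * INR e).
Proof.
move=> /INR_gt0 g0 /INR_gt0 e0; left.
by apply: Rinv_0_lt_compat; apply: Rmult_lt_0_compat.
Qed.

Lemma coprime_sum_le X Y : (X <= Y)%N -> coprime_sum X <= coprime_sum Y.
Proof.
move=> le_XY; apply: rsum_hyperbola_le => // g e g0 e0.
by apply: Rmult_le_pos; [exact: ind_ge0 | exact: inv_mul_ge0].
Qed.

Lemma coprime_sum_ge0 X : 0 <= coprime_sum X.
Proof. exact: (coprime_sum_le (leq0n X)). Qed.

(** [hyperbola_sum - coprime_sum] sums nonnegative terms over non-coprime pairs, so it is
    nondecreasing. *)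
Lemma coprime_sum_diff_le X Y : (X <= Y)%N ->
  coprime_sum Y - coprime_sum X <= hyperbola_sum Y - hyperbola_sum X.
Proof.
move=> le_XY.
have E Z : hyperbola_sum Z - coprime_sum Z = \rsum_(g <= Z) \rsum_(e <= Z %/ g)
    ((1 - ind (coprime g e)) * / (INR g * INR e)).
  rewrite -rsumB; apply: eq_rsum => g _; rewrite -rsumB; apply: eq_rsum => e _.
  lra.
suff : hyperbola_sum X - coprime_sum X <=
    hyperbola_sum Y - coprime_sum Y by lra.
rewrite !E; apply: rsum_hyperbola_le => // g e g0 e0.
apply: Rmult_le_pos; last exact: inv_mul_ge0.
by have := ind_le1 (coprime g e); lra.
Qed.

Definition inv_squares n := \rsum_(d <= n) / INR d ^ 2.

Lemma inv_square_ge0 d : (0 < d)%N -> 0 < / INR d ^ 2.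
Proof. by move=> /INR_gt0 d0; apply: Rinv_0_lt_compat; apply: pow_lt. Qed.

Lemma hyperbola_sum_le X z : inv_squares X <= z ->
  hyperbola_sum X <= coprime_sum X * z.
Proof.
move=> le_z; rewrite hyperbola_sumE.
apply: Rle_trans (_ : coprime_sum X * inv_squares X <= _).
  rewrite -rsumZ; apply: rsum_le => d /andP[d0 _].
  rewrite Rmult_comm; apply: Rmult_le_compat_r.
    by left; apply: inv_square_ge0.
  by apply: coprime_sum_le; apply: leq_div.
by apply: Rmult_le_compat_l; first exact: coprime_sum_ge0.
Qed.

(* [hyperbola_sum - coprime_sum] is nondecreasing, so replacing [X / d^2] by [X]
   in [coprime_sum] costs at most the corresponding increment of
   [hyperbola_sum]. *)
Lemma coprime_sum_le_hyperbola D X : (D <= X)%N ->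
  coprime_sum X * inv_squares D <= hyperbola_sum X +
    \rsum_(d <= D)
      (/ INR d ^ 2 * (hyperbola_sum X - hyperbola_sum (X %/ d ^ 2))).
Proof.
move=> le_DX; rewrite {1}hyperbola_sumE.
apply: Rle_trans (_ : \rsum_(d <= D) (/ INR d ^ 2 * coprime_sum (X %/ d ^ 2)) +
  \rsum_(d <= D) (/ INR d ^ 2 * (hyperbola_sum X - hyperbola_sum (X %/ d ^ 2)))
  <= _).
  rewrite -rsumD -rsumZ; apply: rsum_le => d /andP[d0 _].
  have i0 := inv_square_ge0 d0.
  have := coprime_sum_diff_le (leq_div X (d ^ 2)) => H.
  by nra.
apply: Rplus_le_compat_r; apply: rsum_le_widen => // d /andP[lt_d _].
apply: Rmult_le_pos; last exact: coprime_sum_ge0.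
by left; apply: inv_square_ge0; apply: leq_ltn_trans lt_d.
Qed.

(** From below, [W >= V / z]. From above, for each fixed [D], [W] times the partial sum
    [inv_squares D] is at most [V + o((log n)^2)]; taking [D] large closes the gap. *)
Lemma is_lim_seq_coprime (z : R) : is_lim_seq inv_squares z ->
  is_lim_seq (fun n => coprime_sum n / ln (INR n) ^ 2) (/ (2 * z)).
Proof.
move=> lim_z; have le_z n : inv_squares n <= z.
  apply: is_lim_seq_incr_compare lim_z _ _ => k.
  rewrite /inv_squares [X in _ <= X]/=.
  by have := @inv_square_ge0 k.+1 isT; simpl; lra.
have z1 : 1 <= z by have := le_z 1%N; rewrite /inv_squares /=; lra.
have lim_V := is_lim_seq_hyperbola.
apply/is_lim_seq_spec => eps; have eps0 := cond_pos eps.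
have lim_D : is_lim_seq (fun D => / (2 * inv_squares D)) (/ (2 * z)).
  have H := is_lim_seq_mult' _ _ _ _ (is_lim_seq_const 2) lim_z.
  by apply: (is_lim_seq_inv _ _ H) => /Rbar_finite_eq; lra.
have half0 : 0 < eps / 2 by lra.
have [D0 HD0] := proj2 (is_lim_seq_spec _ _) lim_D (mkposreal _ half0).
(* The successor ensures a nonempty partial sum, so that [inv_squares D >= 1] can be divided by. *)
pose D := D0.+1.
have zD0 : 1 <= inv_squares D.
  have : inv_squares 1 <= inv_squares D.
    apply: rsum_le_widen => // i /andP[lt_i _].
    by left; apply: inv_square_ge0; apply: leq_ltn_trans lt_i.
  by rewrite {1}/inv_squares /=; lra.
have {HD0} HD : / (2 * inv_squares D) < / (2 * z) + eps / 2.
  have := HD0 D (Nat.le_succ_diag_r _).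
  by move=> /Rabs_lt_between /=; lra.
(* The normalised upper bound from [coprime_sum_le_hyperbola]. Each difference in it tends to 0,
   since [V (n / d^2)] and [V n] have the same leading term. *)
pose U n := (hyperbola_sum n / ln (INR n) ^ 2 +
  \rsum_(d <= D) (/ INR d ^ 2 * (hyperbola_sum n / ln (INR n) ^ 2 -
     hyperbola_sum (n %/ d ^ 2) / ln (INR n) ^ 2))) * / inv_squares D.
have lim_U : is_lim_seq U (/ (2 * inv_squares D)).
  have lim_d d : (0 < d <= D)%N -> is_lim_seq (fun n => / INR d ^ 2 *
     (hyperbola_sum n / ln (INR n) ^ 2 -
     hyperbola_sum (n %/ d ^ 2) / ln (INR n) ^ 2)) 0.
    move=> /andP[d0 _]; have dd0 : (0 < d ^ 2)%N by rewrite expn_gt0 d0.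
    have i0 := Rinv_0_lt_compat _ (INR_gt0 dd0).
    have lim_Vd := rescale_ln2 i0 (is_lim_seq_divn dd0) lim_V.
    apply: is_lim_seq_eq (is_lim_seq_mult' _ _ _ _ (is_lim_seq_const _)
      (is_lim_seq_minus' _ _ _ _ lim_V lim_Vd)) _; lra.
  apply: is_lim_seq_eq (is_lim_seq_mult' _ _ _ _ (is_lim_seq_plus' _ _ _ _
     lim_V (is_lim_seq_rsum lim_d)) (is_lim_seq_const _)) _.
  by rewrite rsum_const; field; lra.
have [N1 HN1] := proj2 (is_lim_seq_spec _ _) lim_U (mkposreal _ half0).
have [N2 HN2] := proj2 (is_lim_seq_spec _ _) lim_V eps.
exists (N1 + N2 + D + 2)%N => n le_n.
have /Rabs_lt_between /= {}HN1 := HN1 n ltac:(lia).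
have /Rabs_lt_between {}HN2 := HN2 n ltac:(lia).
have L0 : 0 < ln (INR n) by apply: ln_INR_gt0; lia.
have L2 : 0 < / ln (INR n) ^ 2 by apply: Rinv_0_lt_compat; apply: pow_lt.
have lowW : / z * (hyperbola_sum n / ln (INR n) ^ 2) <=
    coprime_sum n / ln (INR n) ^ 2.
  rewrite /Rdiv -Rmult_assoc; apply: Rmult_le_compat_r; first lra.
  have := hyperbola_sum_le (le_z n) => H.
  apply: (Rmult_le_reg_l z); first lra.
  by rewrite -Rmult_assoc Rinv_r; lra.
have upW : coprime_sum n / ln (INR n) ^ 2 <= U n.
  have le_Dn : (D <= n)%N by lia.
  have H := coprime_sum_le_hyperbola le_Dn.
  apply: (Rmult_le_reg_r (inv_squares D)); first lra.
  rewrite /U [X in _ <= X]Rmult_assoc Rinv_l ?Rmult_1_r; last lra.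
  rewrite /Rdiv Rmult_assoc (Rmult_comm (/ _)) -Rmult_assoc.
  apply: Rle_trans (Rmult_le_compat_r _ _ _ (Rlt_le _ _ L2) H) _.
  right; rewrite Rmult_plus_distr_r; congr (_ + _).
  by rewrite Rmult_comm -rsumZ; apply: eq_rsum => d _; ring.
(* As [/ z <= 1], the error [eps] on [V / (log n)^2] is not enlarged in the lower bound. *)
have iz : 0 < / z <= 1.
  split; first by apply: Rinv_0_lt_compat; lra.
  by rewrite -Rinv_1; apply: Rinv_le_contravar; lra.
have i2z : / (2 * z) = / z * / 2 by rewrite Rinv_mult; lra.
apply/Rabs_lt_between'; rewrite -[_ * (_ * 1)]/(ln (INR n) ^ 2).
rewrite i2z in HD *; split; last lra.
by apply: Rlt_le_trans lowW; nra.
Qed.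

(** * The Basel sum *)

(** [sin t - t cos t] vanishes at 0 and has derivative [t sin t >= 0] on [[0, PI]]. *)
Lemma mul_cos_le_sin x : 0 < x -> x < PI -> x * cos x <= sin x.
Proof.
move=> x0 xpi.
have [] := MVT_gen (fun t => sin t - t * cos t) 0 x (fun t => t * sin t).
- by move=> t _; auto_derive => //; ring.
- move=> t _; apply: derivable_continuous_pt.
  apply: ex_derive_Reals_0; auto_derive => //.
rewrite Rmin_left ?Rmax_right; try lra.
move=> t [[t0 tx]]; rewrite sin_0 => H.
have s0 : 0 <= sin t by apply: sin_ge_0; lra.
by have := Rmult_le_pos _ _ t0 s0; nra.
Qed.

(** These are the inverse squares of [sin y < y <= tan y], because [1 / sin^2 - 1 = 1 / tan^2]. *)
Lemma csc2_bounds y : 0 < y < PI / 2 ->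
  / sin y ^ 2 - 1 <= / y ^ 2 <= / sin y ^ 2.
Proof.
move=> [y0 yp].
have s0 : 0 < sin y by apply: sin_gt_0; lra.
have c0 : 0 < cos y by apply: cos_gt_0; lra.
have sy : sin y < y := sin_lt_x y y0.
split; last by apply: Rinv_le_contravar; [apply: pow_lt | apply: pow_incr; lra].
have -> : / sin y ^ 2 - 1 = / (sin y / cos y) ^ 2.
  have := sin2_cos2 y; rewrite /Rsqr => E.
  rewrite (_ : 1 = sin y ^ 2 / sin y ^ 2); last by field; lra.
  have -> : / sin y ^ 2 - sin y ^ 2 / sin y ^ 2 = (1 - sin y ^ 2) / sin y ^ 2.
    by field; lra.
  by have -> : 1 - sin y ^ 2 = cos y ^ 2; [nra | field; lra].
apply: Rinv_le_contravar; first exact: pow_lt.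
apply: pow_incr; split; first lra.
have := mul_cos_le_sin y0 ltac:(lra) => H.
apply: (Rmult_le_reg_r (cos y)) => //.
by rewrite (_ : _ / _ * _ = sin y) //; field; lra.
Qed.

Lemma csc2_double y : sin y <> 0 -> cos y <> 0 ->
  / sin (2 * y) ^ 2 = / 4 * (/ sin y ^ 2 + / cos y ^ 2).
Proof.
move=> s0 c0; have := sin2_cos2 y; rewrite sin_2a /Rsqr => E.
rewrite (_ : / sin y ^ 2 + _ =
  (sin y * sin y + cos y * cos y) / (sin y * cos y) ^ 2); last by field.
by rewrite E; field.
Qed.

Lemma rsum_rev m F : \rsum_(k <= m) F (m.+1 - k)%N = rsum m F.
Proof.
elim: m F => // m IHm F.
rewrite [RHS]rsum_recl -(IHm (fun k => F k.+1)) [LHS]/=.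
rewrite subSnn Rplus_comm; congr (_ + _).
by apply: eq_rsum => k /andP[_ le_k]; rewrite (subSn (leqW le_k)).
Qed.

Lemma rsum_fold m F :
  rsum (m + m) F = \rsum_(k <= m) (F k + F ((m + m).+1 - k)%N).
Proof.
rewrite rsum_shift rsumD; congr (_ + _).
rewrite -(rsum_rev m (fun k => F (k + m)%N)); apply: eq_rsum => k /andP[_ le_k].
by congr F; lia.
Qed.

(** The odd multiples of [PI / 2^(n+2)]; those with [1 <= k <= 2^n] are the ones in [(0, PI / 2)].
    Doubling the [k]-th angle of level [n + 1] gives the [k]-th of level [n]. *)
Definition basel_angle n k := (2 * INR k - 1) * PI / (4 * 2 ^ n).

Lemma INR_exp2 n : INR (2 ^ n)%N = 2 ^ n.
Proof. by elim: n => // n IHn; rewrite expnS mult_INR IHn. Qed.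

Lemma basel_angle_bounds n k : (0 < k <= 2 ^ n)%N ->
  0 < basel_angle n k < PI / 2.
Proof.
move=> /andP[k0 le_k]; have p0 : 0 < 2 ^ n by apply: pow_lt; lra.
have k1 : 1 <= INR k by apply: (@ler_INR 1).
have := ler_INR le_k; rewrite INR_exp2 => k2; have pi0 := PI_RGT_0.
rewrite /basel_angle; split.
  apply: Rdiv_lt_0_compat; last lra.
  by apply: Rmult_lt_0_compat; lra.
rewrite (_ : PI / 2 = (2 * 2 ^ n) * PI / (4 * 2 ^ n)); last by field; lra.
apply: Rmult_lt_compat_r; first by apply: Rinv_0_lt_compat; lra.
by apply: Rmult_lt_compat_r; lra.
Qed.

(* Halving the angles turns each term into two by [csc2_double]; the cosine is
   the sine of the complementary angle, which has the mirrored index. *)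
Lemma sum_csc2 n : \rsum_(k <= 2 ^ n) / sin (basel_angle n k) ^ 2 = 2 * 4 ^ n.
Proof.
elim: n => [|n IHn].
  rewrite expn0 /rsum /basel_angle /= (_ : _ / _ = PI / 4); last by field.
  have := sin2_cos2 (PI / 4); rewrite -sin_cos_PI4 /Rsqr => E.
  have -> : sin (PI / 4) * (sin (PI / 4) * 1) = / 2 by lra.
  by field.
rewrite expnS mul2n -addnn rsum_fold.
transitivity (4 * \rsum_(k <= 2 ^ n) / sin (basel_angle n k) ^ 2); last first.
  by rewrite IHn /=; ring.
have p0 : 0 < 2 ^ n by apply: pow_lt; lra.
rewrite -rsumZ; apply: eq_rsum => k rk; have [b0 b1] := basel_angle_bounds rk.
have E1 : basel_angle n k = 2 * basel_angle n.+1 k.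
  by rewrite /basel_angle /=; field; lra.
have E2 : basel_angle n.+1 ((2 ^ n + 2 ^ n).+1 - k)%N =
    PI / 2 - basel_angle n.+1 k.
  have le_k : (k <= (2 ^ n + 2 ^ n).+1)%coq_nat.
    by case/andP: rk => _ /leP; lia.
  rewrite /basel_angle minus_INR // S_INR plus_INR INR_exp2 /=.
  by field; lra.
rewrite E2 sin_shift E1 csc2_double; first lra.
  by have := sin_gt_0 (basel_angle n.+1 k); lra.
by have := cos_gt_0 (basel_angle n.+1 k); lra.
Qed.

Definition inv_odd_squares n := \rsum_(k <= n) / (2 * INR k - 1) ^ 2.

(** Summing [csc2_bounds] over the [2^n] angles places the sum of [1 / basel_angle^2] between
    [2 * 4^n - 2^n] and [2 * 4^n]; that sum is [16 * 4^n / PI^2] times the odd sum. *)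
Lemma inv_odd_squares_bounds n :
  PI ^ 2 / 8 * (1 - / 2 * / 2 ^ n) <= inv_odd_squares (2 ^ n) <= PI ^ 2 / 8.
Proof.
have pi0 := PI_RGT_0; have p0 : 0 < 2 ^ n by apply: pow_lt; lra.
have f0 : 4 ^ n = 2 ^ n * 2 ^ n by rewrite -Rpow_mult_distr; congr (_ ^ _); lra.
have E : \rsum_(k <= 2 ^ n) / basel_angle n k ^ 2 =
    16 * 4 ^ n / PI ^ 2 * inv_odd_squares (2 ^ n).
  rewrite -rsumZ; apply: eq_rsum => k /andP[k0 _].
  have k1 : 1 <= INR k by apply: (@ler_INR 1).
  by rewrite /basel_angle f0; field; lra.
have up : \rsum_(k <= 2 ^ n) / basel_angle n k ^ 2 <= 2 * 4 ^ n.
  rewrite -sum_csc2; apply: rsum_le => k rk.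
  by have := csc2_bounds (basel_angle_bounds rk); lra.
have low : 2 * 4 ^ n - 2 ^ n <= \rsum_(k <= 2 ^ n) / basel_angle n k ^ 2.
  have -> : 2 ^ n = \rsum_(k <= 2 ^ n) 1 by rewrite rsum_const INR_exp2; ring.
  rewrite -sum_csc2 -rsumB.
  apply: rsum_le => k rk.
  by have := csc2_bounds (basel_angle_bounds rk); lra.
have c0 : 0 < PI ^ 2 / (16 * 4 ^ n).
  by apply: Rdiv_lt_0_compat; [nra | rewrite f0; nra].
have E' : inv_odd_squares (2 ^ n) =
    PI ^ 2 / (16 * 4 ^ n) * \rsum_(k <= 2 ^ n) / basel_angle n k ^ 2.
  by rewrite E f0; field; lra.
rewrite E'; split.
  have -> : PI ^ 2 / 8 * (1 - / 2 * / 2 ^ n) =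
      PI ^ 2 / (16 * 4 ^ n) * (2 * 4 ^ n - 2 ^ n) by rewrite f0; field; lra.
  by apply: Rmult_le_compat_l; lra.
have -> : PI ^ 2 / 8 = PI ^ 2 / (16 * 4 ^ n) * (2 * 4 ^ n).
  by rewrite f0; field; lra.
by apply: Rmult_le_compat_l; lra.
Qed.

Lemma inv_squares_double m :
  inv_squares (m + m) = inv_odd_squares m + / 4 * inv_squares m.
Proof.
rewrite /inv_squares /inv_odd_squares.
elim: m => [|m IHm]; first by rewrite /=; lra.
rewrite addSn addnS /rsum -/rsum IHm !S_INR plus_INR.
have m0 := pos_INR m.
by field; lra.
Qed.

Lemma inv_squares_le m n : (m <= n)%N -> inv_squares m <= inv_squares n.
Proof.
move=> le_mn; apply: rsum_le_widen => // d /andP[lt_d _].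
by left; apply: inv_square_ge0; apply: leq_ltn_trans lt_d.
Qed.

(** Splitting into odd and even terms along powers of two bounds the increasing partial sums, so a
    limit [l] exists. The same splitting gives [l = PI^2 / 8 + l / 4]. *)
Lemma basel : is_lim_seq inv_squares (PI ^ 2 / 6).
Proof.
have pow2_inf : filterlim (fun n => (2 ^ n)%N) eventually eventually.
  move=> P [N PN]; exists N => n le_n; apply: PN.
  by have := ltn_expl n (isT : 1 < 2)%N; lia.
have [l lim_l] : ex_finite_lim_seq inv_squares.
  apply: (@ex_finite_lim_seq_incr _ (PI ^ 2 / 6)) => n.
    exact: inv_squares_le.
  have le_n : inv_squares n <= inv_squares (2 ^ n).
    by apply: inv_squares_le; apply: ltnW; apply: ltn_expl.
  have := inv_squares_double (2 ^ n); have := inv_odd_squares_bounds n.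
  have := inv_squares_le (leq_addr (2 ^ n) (2 ^ n)); lra.
have lim2 := is_lim_seq_subseq _ _ _ pow2_inf lim_l.
have lim2' : is_lim_seq (fun n => inv_squares (2 ^ n + 2 ^ n)) l.
  apply: (is_lim_seq_subseq _ _ (fun n => (2 ^ n + 2 ^ n)%N)) lim_l.
  move=> P /pow2_inf [N PN]; exists N => n le_n.
  by rewrite addnn -mul2n -expnS; apply: PN; lia.
have lim_odd : is_lim_seq (fun n => inv_odd_squares (2 ^ n)) (PI ^ 2 / 8).
  have lim_geom : is_lim_seq (fun n => / 2 * (/ 2) ^ n) 0.
    apply: is_lim_seq_eq (is_lim_seq_mult' _ _ _ _ (is_lim_seq_const _)
      (is_lim_seq_geom (/ 2) _)) _; last lra.
    by rewrite Rabs_right; lra.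
  apply: (@is_lim_seq_le_le (fun n => PI ^ 2 / 8 * (1 - / 2 * (/ 2) ^ n)) _
    (fun=> PI ^ 2 / 8)).
  - by move=> n; rewrite pow_inv; exact: inv_odd_squares_bounds.
  - apply: is_lim_seq_eq (is_lim_seq_mult' _ _ _ _ (is_lim_seq_const _)
      (is_lim_seq_minus' _ _ _ _ (is_lim_seq_const _) lim_geom)) _; lra.
  - exact: is_lim_seq_const.
have lim_sum : is_lim_seq (fun n => inv_squares (2 ^ n + 2 ^ n))
    (PI ^ 2 / 8 + / 4 * l).
  apply: (@is_lim_seq_ext (fun n => inv_odd_squares (2 ^ n) +
      / 4 * inv_squares (2 ^ n))).
    by move=> n; rewrite inv_squares_double.
  apply: is_lim_seq_plus' => //.
  by apply: is_lim_seq_mult' => //; exact: is_lim_seq_const.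
have := is_lim_seq_unique _ _ lim2'; rewrite (is_lim_seq_unique _ _ lim_sum).
by case=> E; apply: is_lim_seq_eq lim_l _; lra.
Qed.

(** * Asymptotics *)

(** By [basel], [W(n) / (log n)^2] tends to [1 / (2 * PI^2 / 6) = 3 / PI^2], and slow variation
    gives the same limit for each [W(n / d^2)]. The error [n * harmonic n] is [o(n (log n)^2)]. *)
Lemma is_lim_seq_lattice_count h : (0 < h)%N ->
  is_lim_seq (fun n => lattice_count h n / (INR n * ln (INR n) ^ 2))
    (\rsum_(d <= h) (ind (d %| h) * (/ INR d * (3 / PI ^ 2)))).
Proof.
move=> h0; have pi0 := PI_RGT_0.
have lim_C : is_lim_seq (fun n => coprime_sum n / ln (INR n) ^ 2) (3 / PI ^ 2).
  by apply: is_lim_seq_eq (is_lim_seq_coprime basel) _; field; lra.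
have lim_d d : (0 < d <= h)%N -> is_lim_seq (fun n => ind (d %| h) *
    (/ INR d * (coprime_sum (n %/ d ^ 2) / ln (INR n) ^ 2)))
    (ind (d %| h) * (/ INR d * (3 / PI ^ 2))).
  move=> /andP[d0 _]; have dd0 : (0 < d ^ 2)%N by rewrite expn_gt0 d0.
  have i0 := Rinv_0_lt_compat _ (INR_gt0 dd0).
  apply: is_lim_seq_mult'; first exact: is_lim_seq_const.
  apply: is_lim_seq_mult'; first exact: is_lim_seq_const.
  have H := rescale_ln2 i0 (is_lim_seq_divn dd0) lim_C.
  exact: H.
apply: is_lim_seq_squeeze (is_lim_seq_rsum lim_d)
  (_ : is_lim_seq (fun n => (INR h + 3) *
    (harmonic n / ln (INR n) * / ln (INR n))) 0).
  exists 2%N => n /leP n2.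
  have L0 := ln_INR_gt0 n2; have n0 := INR_gt0 (ltnW n2).
  have L2 : 0 < / (INR n * ln (INR n) ^ 2).
    by apply: Rinv_0_lt_compat; apply: Rmult_lt_0_compat => //; apply: pow_lt.
  rewrite (_ : rsum _ _ = INR n * (\rsum_(d <= h)
     (ind (d %| h) * (/ INR d * coprime_sum (n %/ d ^ 2)))) *
     / (INR n * ln (INR n) ^ 2)); last first.
    transitivity (/ ln (INR n) ^ 2 * \rsum_(d <= h)
     (ind (d %| h) * (/ INR d * coprime_sum (n %/ d ^ 2)))).
      by rewrite -rsumZ; apply: eq_rsum => d _; rewrite /Rdiv; ring.
    by field; lra.
  rewrite /Rdiv -Rmult_minus_distr_r Rabs_mult (Rabs_right (/ _)); last lra.
  apply: Rle_trans
    (Rmult_le_compat_r _ _ _ (Rlt_le _ _ L2) (lattice_count_dist n h0)) _.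
  by right; field; lra.
apply: is_lim_seq_eq (is_lim_seq_mult' _ _ _ _ (is_lim_seq_const _)
  (is_lim_seq_mult' _ _ _ _ is_lim_seq_harmonic is_lim_seq_inv_ln_INR)) _; lra.
Qed.

(** In [lattice_countE] the term [f = 1] is the sum sought. By induction every other divisor [f]
    contributes [(1 / f) (3 / PI^2)], cancelling the matching term in the limit of [lattice_count]
    and leaving that of [d = 1]. *)
Lemma is_lim_seq_small_sum h : (0 < h)%N ->
  is_lim_seq (fun n => small_sum h n / (INR n * ln (INR n) ^ 2)) (3 / PI ^ 2).
Proof.
elim/ltn_ind: h => -[//|h] IH _.
(* The index is shifted: [f.+1] runs over the candidates from 2 to [h.+1]. *)
have lim_f f : (0 < f <= h)%N -> is_lim_seq (fun n => ind (f.+1 %| h.+1) *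
    (small_sum (h.+1 %/ f.+1) (n %/ f.+1) / (INR n * ln (INR n) ^ 2)))
    (ind (f.+1 %| h.+1) * (/ INR f.+1 * (3 / PI ^ 2))).
  move=> /andP[f0 le_fh].
  apply: is_lim_seq_mult'; first exact: is_lim_seq_const.
  apply: (rescale_nln2 (Rinv_0_lt_compat _ (INR_gt0 (ltn0Sn f)))).
    exact: is_lim_seq_divn.
  apply: IH; last by rewrite divn_gt0.
  by rewrite ltn_Pdiv.
have := is_lim_seq_minus' _ _ _ _
  (is_lim_seq_lattice_count (ltn0Sn h)) (is_lim_seq_rsum lim_f).
rewrite rsum_recl dvd1n => H.
apply: (@is_lim_seq_ext (fun n =>
  lattice_count h.+1 n / (INR n * ln (INR n) ^ 2)
  - \rsum_(f <= h) (ind (f.+1 %| h.+1) * (small_sum (h.+1 %/ f.+1)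
      (n %/ f.+1) / (INR n * ln (INR n) ^ 2))))).
  move=> n; rewrite lattice_countE // rsum_recl dvd1n !divn1 /Rdiv.
  rewrite Rmult_plus_distr_r (Rmult_comm (rsum _ _)) -rsumZ.
  rewrite [X in _ + X - _](@eq_rsum _ _ (fun f => ind (f.+1 %| h.+1) *
    (small_sum (h.+1 %/ f.+1) (n %/ f.+1) * / (INR n * ln (INR n) ^ 2)))).
    by rewrite /ind; ring.
  by move=> f _; ring.
apply: is_lim_seq_eq H _; rewrite /ind /= Rinv_1; lra.
Qed.

(** The error of at most [h] per term adds up to [n h], negligible against [n (log n)^2]. *)
Lemma is_lim_seq_sum_tau h : (0 < h)%N ->
  is_lim_seq (fun n => (\rsum_(m <= n) INR (tau (m * (m + h)))) /
    (INR n * ln (INR n) ^ 2)) (6 / PI ^ 2).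
Proof.
move=> h0.
apply: (@is_lim_seq_squeeze _
  (fun n => 2 * (small_sum h n / (INR n * ln (INR n) ^ 2)))
  (fun n => INR h * (/ ln (INR n) * / ln (INR n)))).
- exists 2%N => n /leP n2.
  have L0 := ln_INR_gt0 n2; have n0 := INR_gt0 (ltnW n2).
  have L2 : 0 < / (INR n * ln (INR n) ^ 2).
    by apply: Rinv_0_lt_compat; apply: Rmult_lt_0_compat => //; apply: pow_lt.
  have D : Rabs (\rsum_(m <= n) INR (tau (m * (m + h))) - 2 * small_sum h n) <=
      INR n * INR h.
    rewrite -rsumZ -rsum_const; apply: rsum_dist_le => m /andP[m0 _].
    by have := tau_small_divisors h0 m0 => ?; apply: Rabs_le; lra.
  rewrite /Rdiv -Rmult_assoc -Rmult_minus_distr_r Rabs_mult.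
  rewrite (Rabs_right (/ _)); last lra.
  apply: Rle_trans (Rmult_le_compat_r _ _ _ (Rlt_le _ _ L2) D) _.
  by right; field; lra.
- apply: is_lim_seq_eq (is_lim_seq_mult' _ _ _ _ (is_lim_seq_const _)
    (is_lim_seq_small_sum h0)) _; lra.
- apply: is_lim_seq_eq (is_lim_seq_mult' _ _ _ _ (is_lim_seq_const _)
    (is_lim_seq_mult' _ _ _ _ is_lim_seq_inv_ln_INR
      is_lim_seq_inv_ln_INR)) _; lra.
Qed.

(** * Return to the integers [b], [c] and [N] *)

Lemma S_tauE b c N : (b < c)%Z ->
  INR (S_tau b c N) =
  \rsum_(m <= Z.to_nat (N - c)) INR (tau (m * (m + Z.to_nat (c - b)))).
Proof.
move=> lt_bc; rewrite /S_tau /Zinterval_oc map_map.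
set h := Z.to_nat (c - b).
have hE : Z.of_nat h = (c - b)%Z by rewrite /h Z2Nat.id //; lia.
elim: (Z.to_nat (N - c)) => // n IHn.
rewrite seq_S map_app fold_right_app /= -IHn.
rewrite (_ : Z.to_nat _ = (n.+1 * (n.+1 + h))%N); last first.
  have -> : (c + Z.of_nat n.+1 - b)%Z = Z.of_nat (n.+1 + h).
    by rewrite Nat2Z.inj_add hE; lia.
  have -> : (c + Z.of_nat n.+1 - c)%Z = Z.of_nat n.+1 by lia.
  by rewrite -Nat2Z.inj_mul Nat2Z.id mulnC.
(* The induction appends the new term at the end of the list, where [fold_right] takes it as its
   initial value. *)
have foldE (s : list nat) x :
    fold_right Nat.add x s = (fold_right Nat.add 0 s + x)%N.
  by elim: s => //= y s ->; lia.
by rewrite foldE Nat.add_0_r plus_INR.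
Qed.

Lemma is_lim_seq_shift_ratio (c : Z) :
  is_lim_seq (fun N : nat => INR (Z.to_nat (Z.of_nat N - c)) / INR N) 1.
Proof.
apply: (@is_lim_seq_ext_loc (fun N => 1 - IZR c * / INR N)).
  (* Beyond [c] the difference [N - c] is positive and [Z.to_nat] does not truncate it. *)
  exists (Z.to_nat c + 1)%N => N le_N.
  have N0 : 0 < INR N by apply: INR_gt0; lia.
  rewrite (INR_IZR_INZ (Z.to_nat _)) Z2Nat.id; last lia.
  by rewrite minus_IZR -INR_IZR_INZ; field; lra.
have lim_inv : is_lim_seq (fun n => / INR n) 0.
  by have := is_lim_seq_inv _ _ is_lim_seq_INR; apply.
apply: is_lim_seq_eq (is_lim_seq_minus' _ _ _ _ (is_lim_seq_const 1)
  (is_lim_seq_mult' _ _ _ _ (is_lim_seq_const (IZR c)) lim_inv)) _; lra.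
Qed.

Unset Implicit Arguments.

(* S(N) ~ (6/pi^2) N log^2 N as N -> infinity (N ranging over naturals). *)
Theorem theorem2 (b c : Z) (hbc : (b < c)%Z) (hpar : Z.even b = Z.even c) :
  Un_cv (fun N : nat =>
           INR (S_tau b c (Z.of_nat N)) /
           (6 / PI ^ 2 * INR N * (ln (INR N)) ^ 2)) 1.
Proof.
have pi0 := PI_RGT_0; apply/is_lim_seq_Reals.
have h0 : (0 < Z.to_nat (c - b))%N by lia.
(* The sum has [N - c] terms; as [(N - c) / N] tends to 1, it may be normalised by [N (log N)^2]. *)
have := rescale_nln2 Rlt_0_1 (is_lim_seq_shift_ratio c) (is_lim_seq_sum_tau h0).
move=> lim_S; apply: (@is_lim_seq_ext_loc (fun N => PI ^ 2 / 6 *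
    (INR (S_tau b c (Z.of_nat N)) / (INR N * ln (INR N) ^ 2)))).
  exists 2%N => N /leP N2.
  have L0 := ln_INR_gt0 N2; have N0 := INR_gt0 (ltnW N2).
  by field; lra.
apply: is_lim_seq_eq (is_lim_seq_mult' _ _ _ _ (is_lim_seq_const _)
  (is_lim_seq_ext _ _ _ _ lim_S)) _; last by field; lra.
by move=> N /=; rewrite S_tauE.
Qed.
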